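(* Let $(X,\mathcal E_v)$ be an infinite, locally finite, connected tree with root $o$, let $\Phi: X\to\mathcal K$ be a map satisfying (A1) and (A2) (with constants $\delta_0>1$, $0<r<1$), let $\kappa>0$, and let $(X,\mathcal E)$, $\mathcal E=\mathcal E_v\cup\mathcal E_h$, be the associated augmented tree. Then $(X,\mathcal E)$ is a hyperbolic graph in the sense of Gromov.
   Context: Graphs are undirected and simple; edge sets are symmetric subsets of $X\times X\setminus\{(x,x):x\in X\}$. For the tree $(X,\mathcal E_v)$ with root $o$, $|x|$ denotes the length of the non-self-intersecting path from $o$ to $x$, $X_n=\{x\in X:|x|=n\}$, and $\Sigma(x)=\{y\in X: |y|=|x|+1,\ (x,y)\in\mathcal E_v\}$ is the set of offsprings of $x$. $\mathcal K$ is the collection of nonempty compact subsets of $\mathbb R^d$; for $E\subset\mathbb R^d$, $|E|$ denotes the diameter of $E$, and $\mathrm{dist}(E,F)=\inf\{|a-b|:a\in E,b\in F\}$. Conditions on $\Phi:X\to\mathcal K$: (A1) $\Phi(y)\subset\Phi(x)$ for all $x\in X$ and $y\in\Sigma(x)$; (A2) there exist $\delta_0>1$ and $0<r<1$ such that $\delta_0^{-1}r^n\le|\Phi(x)|\le\delta_0 r^n$ for all $n\ge 0$ and all $x\in X_n$. Augmented tree: for a fixed $\kappa>0$, the set of horizontal edges is $$\mathcal E_h=\{(x,y)\in X\times X: |x|=|y|,\ x\ne y,\ \mathrm{dist}(\Phi(x),\Phi(y))\le\kappa r^{|x|}\},$$ and the augmented tree is the graph $(X,\mathcal E)$ with $\mathcal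 E=\mathcal E_v\cup\mathcal E_h$. Hyperbolicity: let $d$ be the graph distance of $(X,\mathcal E)$ (so $|x|=d(o,x)$) and let $|x\wedge y|=\frac12(|x|+|y|-d(x,y))$ be the Gromov product. The graph is hyperbolic if there is a constant $\delta>0$ such that $|x\wedge y|\ge\min\{|x\wedge z|,|z\wedge y|\}-\delta$ for all $x,y,z\in X$. *)

(* Defs.v *)
From HB Require Import structures.
From mathcomp Require Import all_boot all_order all_algebra.
From mathcomp Require Import all_classical all_reals all_analysis.

Set Implicit Arguments.
Unset Strict Implicit.
Unset Printing Implicit Defensive.
Import Order.TTheory GRing.Theory Num.Theory.
Import numFieldNormedType.Exports.

Local Open Scope classical_set_scope.
Local Open Scope ring_scope.

Section Graphs.
Variable X : choiceType.
Implicit Types (e : rel X) (o x y : X) (p c : seq X).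

(* Walks follow the convention of [path]: [x :: p] is the list of visited
   vertices, so the length of the walk is [size p]. *)
Definition walks e x y : set (seq X) :=
  [set p | path e x p /\ last x p = y].

Definition simple_graph e : Prop := symmetric e /\ irreflexive e.

Definition connected_graph e : Prop := forall x y, walks e x y !=set0.

Definition locally_finite e : Prop :=
  forall x, finite_set [set y | e x y].

(* An edge traversed back and forth is a [ucycle] of size 2; genuine cycles of
   a simple graph have size at least 3. *)
Definition acyclic_graph e : Prop :=
  forall c, ucycle e c -> (size c <= 2)%N.

Definition is_tree e : Prop :=
  [/\ simple_graph e, connected_graph e & acyclic_graph e].

(* 0 when x and y are not connected *)
Definition gdist e x y : nat :=
  xget 0%N [set n | (exists2 p, walks e x y p & size p = n) /\
                    (forall p, walks e x y p -> (n <= size p)%N)].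

(* |x|: the chosen path is unique when e is a tree *)
Definition level e o x : nat :=
  size (xget [::] [set p | walks e o x p /\ uniq (o :: p)]).

Definition offspring e o x : set X :=
  [set y | level e o y = (level e o x).+1 /\ e x y].

Definition gromov_product (R : realType) e o x y : R :=
  ((gdist e o x)%:R + (gdist e o y)%:R - (gdist e x y)%:R) / 2.

Definition hyperbolic (R : realType) e o : Prop :=
  exists2 delta : R, 0 < delta &
    forall x y z, Num.min (gromov_product R e o x z) (gromov_product R e o z y)
                    - delta <= gromov_product R e o x y.

End Graphs.

Section Euclidean.
Variables (R : realType) (d : nat).
Implicit Types (u v : 'rV[R]_d) (E F : set 'rV[R]_d).

(* The library's norm on ['rV[R]_d] is the max norm; it induces the same
   topology, hence the same compact sets. *)
Definition enorm u : R := Num.sqrt (\sum_(i < d) u ord0 i ^+ 2).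

Definition diam E : R := sup [set enorm (u - v) | u in E & v in E].

Definition set_dist E F : R := inf [set enorm (u - v) | u in E & v in F].

Definition nonempty_compact E : Prop := E !=set0 /\ compact E.

End Euclidean.

Section AugmentedTree.
Variables (R : realType) (d : nat) (X : choiceType) (Ev : rel X) (o : X).
Variable Phi : X -> set 'rV[R]_d.

Definition condA1 : Prop :=
  forall x y, offspring Ev o x y -> Phi y `<=` Phi x.

Definition condA2 (delta0 r : R) : Prop :=
  forall (n : nat) (x : X), level Ev o x = n ->
    delta0^-1 * r ^+ n <= diam (Phi x) <= delta0 * r ^+ n.

Definition horizontal_edge (kappa r : R) : rel X := fun x y =>
  [&& level Ev o x == level Ev o y, x != y
    & set_dist (Phi x) (Phi y) <= kappa * r ^+ level Ev o x].

Definition augmented_edge (kappa r : R) : rel X := fun x y =>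
  Ev x y || horizontal_edge kappa r x y.

End AugmentedTree.

(* Main.v *)
(* Along any walk of length L from x to y, the i-th vertex has level at least
   max(|x| - i, |y| - L + i), so the sets Phi met by the walk have diameters and
   gaps bounded by two geometric series starting at r^((|x| + |y| - L) / 2);
   hence points of Phi x and Phi y are O(r^(x|y)) apart, (x|y) being the Gromov
   product. By the triangle inequality through Phi z, points of Phi x and Phi y
   are O(r^m) apart for m = min((x|z), (z|y)). By (A1), a fixed number k of
   levels above m the ancestors of x and y are then equal or horizontally
   adjacent, and going up, across and down gives (x|y) >= m - k - 1/2. *)

Require Import Defs.
From mathcomp Require Import all_boot all_order all_algebra.
From mathcomp Require Import all_classical all_reals all_analysis.
From mathcomp Require Import zify ring lra.

Set Implicit Arguments.
Unset Strict Implicit.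
Unset Printing Implicit Defensive.
Import Order.TTheory GRing.Theory Num.Theory.
Import numFieldNormedType.Exports.

Local Open Scope classical_set_scope.
Local Open Scope ring_scope.

(** * Graph distance, and levels in a tree *)

Section Graphs.
Variables (X : choiceType) (e : rel X).
Implicit Types (x y : X) (p q : seq X).

(** Walk lengths are natural numbers, so a single walk ensures a minimum, and the default value in
    [gdist] does not intervene. *)
Lemma gdist_min x y : walks e x y !=set0 ->
  (exists2 p, walks e x y p & size p = gdist e x y) /\
  (forall p, walks e x y p -> (gdist e x y <= size p)%N).
Proof.
move=> [p0 wp0].
have exn : exists n, `[< exists2 p, walks e x y p & size p = n >].
  by exists (size p0); apply/asboolP; exists p0.
apply: (@xgetPex _ 0%N [set n | (exists2 p, walks e x y p & size p = n) /\
                    (forall p, walks e x y p -> (n <= size p)%N)]).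
case: (ex_minnP exn) => n /asboolP wn nmin; exists n; split => // p wp.
by apply: nmin; apply/asboolP; exists p.
Qed.

Lemma walks_cat x y z p q :
  walks e x y p -> walks e y z q -> walks e x z (p ++ q).
Proof.
by move=> [ep <-] [eq <-]; split; rewrite ?last_cat // cat_path ep eq.
Qed.

Hypothesis etree : is_tree e.

(** The edge closes the simple path into a [ucycle], which has at most two vertices by
    acyclicity. *)
Lemma simple_path_edge x y p :
  e y x -> walks e x y p -> uniq (x :: p) -> (size p <= 1)%N.
Proof.
case: etree => _ _ acyc eyx [ep lp] up.
suff : (size (x :: p) <= 2)%N by [].
by apply: acyc; rewrite /ucycle /= rcons_path ep lp eyx.
Qed.

(** Let [a] be the vertex after [x] on the first path. If [q] meets [a], its segment up to [a] is
    closed by an edge back to [x], hence is a single edge, and induction compares the tails.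
    Otherwise [a :: x :: q] is simple with the same end, so by induction [x] recurs on the first
    path, a contradiction. *)
Lemma simple_path_uniq x y p q :
  walks e x y p -> uniq (x :: p) -> walks e x y q -> uniq (x :: q) -> p = q.
Proof.
case: (etree) => -[esym _] _ _.
elim: p x q => [|a p IH] x q.
  move=> [_ /= xy] _ [_ lq]; case: q lq => //= b q lq /andP[/negP[]].
  by rewrite xy -lq mem_last.
move=> [/= /andP[exa ep] lp] /andP[xap uap] [eq lq] uq.
have [aq|aq] := boolP (a \in q).
  case/splitPr: aq eq lq uq => q1 q2.
  rewrite cat_path last_cat /= => /and3P[eq1 elq1a eq2] lq uq.
  have q10 : q1 = [::].
    have : (size (rcons q1 a) <= 1)%N.
      apply: (@simple_path_edge x a); first by rewrite esym.
        by split; rewrite ?last_rcons // rcons_path eq1.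
      have {}uq : uniq ((x :: rcons q1 a) ++ q2) by rewrite cat_cons cat_rcons.
      by move: uq; rewrite cat_uniq => /andP[].
    by rewrite size_rcons; case: (q1).
  rewrite {}q10 /= in uq eq2 lq *; congr cons.
  by apply: (IH a) => //; case/andP: uq.
suff pE : p = x :: q by rewrite pE !inE eqxx orbT in xap.
apply: (IH a) => //; first by split => //=; rewrite esym exa.
rewrite /= uq andbT inE negb_or aq andbT.
by apply: contraNneq xap => ->; rewrite mem_head.
Qed.

Variable o : X.

Lemma level_simple_path x p :
  walks e o x p -> uniq (o :: p) -> level e o x = size p.
Proof.
move=> wp up; rewrite /level; case: xgetP => [q -> [wq uq]|/(_ p)[]//].
by rewrite (simple_path_uniq wp up wq uq).
Qed.

Lemma level_path_ex x :
  exists p, [/\ walks e o x p, uniq (o :: p) & level e o x = size p].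
Proof.
case: (etree) => _ /(_ o x)[p [ep lp]] _.
move: lp; case/shortenP: ep => q eq uq _ lq.
by exists q; split => //; apply: level_simple_path.
Qed.

(** The simple path from [o] to [x] either avoids [y] and extends to it, or passes through [y], and
    then its remainder is a single edge. *)
Lemma level_edge x y : e x y ->
  level e o y = (level e o x).+1 \/ level e o x = (level e o y).+1.
Proof.
move=> exy; case: (etree) => -[esym eirr] _ _.
have [p [[ep lp] up ->]] := level_path_ex x.
have [yp|yp] := boolP (y \in o :: p); last first.
  left; rewrite -(size_rcons p y); apply: level_simple_path.
    by split; rewrite ?last_rcons // rcons_path ep lp.
  by rewrite -rcons_cons rcons_uniq yp.
right; case/splitPl: yp ep lp up => p1 p2 ly.
rewrite cat_path last_cat ly => /andP[ep1 ep2] lx up.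
have -> : level e o y = size p1.
  apply: level_simple_path => //.
  by move: up; rewrite -cat_cons cat_uniq => /andP[].
have up2 : uniq (y :: p2).
  move: up; rewrite -cat_cons cat_uniq => /and3P[_ /hasPn h up2].
  by rewrite /= up2 andbT; apply/negP => /h; rewrite /= -ly mem_last.
have := @simple_path_edge y x p2 exy (conj ep2 lx) up2.
rewrite size_cat; case: p2 lx {ep2 up up2} => [/= yx|a [|//] _ _].
  by rewrite yx eirr in exy.
by rewrite addn1.
Qed.

Lemma level0 x : level e o x = 0%N -> x = o.
Proof. by have [[|a p] [[_ <-] _ ->]] := level_path_ex x. Qed.

Lemma parent_ex x n : level e o x = n.+1 ->
  exists u, [/\ level e o u = n, offspring e o u x & e x u].
Proof.
have [p [[ep lp] up lx]] := level_path_ex x.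
rewrite lx; case/lastP: p ep lp up lx => // p a.
rewrite last_rcons rcons_path => /andP[ep ea] ax; subst a.
rewrite -rcons_cons rcons_uniq size_rcons => /andP[_ up] lx [<-].
have lu : level e o (last o p) = size p by apply: level_simple_path.
case: (etree) => -[esym _] _ _.
exists (last o p); split=> //; last by rewrite esym.
by split => //; rewrite lu.
Qed.

End Graphs.

(** * Euclidean norm, diameter and distance between sets *)

Section Euclidean.
Variables (R : realType) (d : nat).
Implicit Types (u v w : 'rV[R]_d) (E F : set 'rV[R]_d).

Lemma enorm_ge0 u : 0 <= enorm u. Proof. exact: sqrtr_ge0. Qed.

Lemma sqr_enorm u : enorm u ^+ 2 = \sum_(i < d) u ord0 i ^+ 2.
Proof. by rewrite sqr_sqrtr // sumr_ge0 // => i _; rewrite sqr_ge0. Qed.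

Lemma enorm_sub0 u : enorm (u - u) = 0.
Proof.
by rewrite /enorm big1 ?sqrtr0 // => i _; rewrite subrr mxE expr0n.
Qed.

Lemma cauchy_schwarz u v :
  \sum_(i < d) u ord0 i * v ord0 i <= enorm u * enorm v.
Proof.
set C := \sum_(i < d) _; set s := enorm u; set t := enorm v.
have s0 : 0 <= s := enorm_ge0 u.
have t0 : 0 <= t := enorm_ge0 v.
(* Expanding the sum of squares gives this product; dividing by [s * t] leaves only the case where
   one of the vectors vanishes. *)
have sq : 0 <= 2 * (s * t) * (s * t - C).
  have -> : 2 * (s * t) * (s * t - C) =
      \sum_(i < d) (t * u ord0 i - s * v ord0 i) ^+ 2.
    rewrite (eq_bigr (fun i => t ^+ 2 * u ord0 i ^+ 2 + s ^+ 2 * v ord0 i ^+ 2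
      - 2 * (s * t) * (u ord0 i * v ord0 i))); last by move=> i _; ring.
    rewrite !big_split /= sumrN -!mulr_sumr -!sqr_enorm -/s -/t -/C; ring.
  by apply: sumr_ge0 => i _; rewrite sqr_ge0.
have [st0|st0] := ltP 0 (s * t).
  by rewrite pmulr_rge0 ?subr_ge0 // in sq; rewrite mulr_gt0.
suff -> : C = 0 by rewrite mulr_ge0.
have : s * t = 0 by apply/eqP; rewrite eq_le st0 mulr_ge0.
move=> /eqP; rewrite mulf_eq0 /C => /orP[|] /eqP n0.
  have := sqr_enorm u; rewrite -/s n0 expr0n => /esym/eqP.
  rewrite psumr_eq0; last by move=> i _; rewrite sqr_ge0.
  move=> /allP h; apply: big1 => i _.
  have := h i (mem_index_enum i); rewrite /= sqrf_eq0 => /eqP ->.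
  by rewrite mul0r.
have := sqr_enorm v; rewrite -/t n0 expr0n => /esym/eqP.
rewrite psumr_eq0; last by move=> i _; rewrite sqr_ge0.
move=> /allP h; apply: big1 => i _.
have := h i (mem_index_enum i); rewrite /= sqrf_eq0 => /eqP ->.
by rewrite mulr0.
Qed.

Lemma enorm_triangle u v w : enorm (u - w) <= enorm (u - v) + enorm (v - w).
Proof.
have -> : u - w = (u - v) + (v - w) by rewrite addrA subrK.
move: (u - v) (v - w) => a b.
rewrite -ler_sqr ?nnegrE ?addr_ge0 ?enorm_ge0 //.
rewrite sqrrD !sqr_enorm.
under eq_bigr do rewrite mxE sqrrD.
rewrite !big_split /=; have := cauchy_schwarz a b; lra.
Qed.

Lemma set_dist_le E F u v : E u -> F v -> set_dist E F <= enorm (u - v).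
Proof.
move=> Eu Fv; apply: ge_inf; last by exists u => //; exists v.
by exists 0 => _ [a _ [b _ <-]]; exact: enorm_ge0.
Qed.

Lemma set_dist_lt E F c : E !=set0 -> F !=set0 -> set_dist E F < c ->
  exists u v, [/\ E u, F v & enorm (u - v) < c].
Proof.
move=> [u0 Eu0] [v0 Fv0] /inf_lt.
have hi : has_inf [set enorm (u - v) | u in E & v in F].
  split; first by exists (enorm (u0 - v0)), u0 => //; exists v0.
  by exists 0 => _ [a _ [b _ <-]]; exact: enorm_ge0.
by move=> /(_ hi.1)[_ [u Eu [v Fv <-]] uv]; exists u, v.
Qed.

(* [sup] is 0 on unbounded sets, hence the positivity hypothesis. *)
Lemma enorm_le_diam E u v : 0 < diam E -> E u -> E v -> enorm (u - v) <= diam E.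
Proof.
move=> E0 Eu Ev; apply: sup_upper_bound; last by exists u => //; exists v.
by apply: contrapT => /sup_out; rewrite -/(diam E) => h; rewrite h ltxx in E0.
Qed.

End Euclidean.

(** * Geometric sums along integer sequences with steps at most one, such as the levels along a
    walk *)

Definition near : rel nat := fun m n => (m <= n.+1)%N && (n <= m.+1)%N.

Lemma near_last a s : path near a s ->
  (last a s <= a + size s)%N /\ (a <= last a s + size s)%N.
Proof.
elim: s a => [a _|b s IH a /= /andP[/andP[? ?] /IH]]; rewrite /=; lia.
Qed.

Section SlowSequences.
Variables (R : realType) (r : R).
Hypothesis hr : 0 < r < 1.

Lemma expr_anti m n : (m <= n)%N -> r ^+ n <= r ^+ m.
Proof.
move=> mn; case/andP: hr => r0 r1.
by apply: ler_wiXn2l => //; exact: ltW.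
Qed.

(** The [i]-th entry is at least [m + size s - i], so the sum is at most that of
    [r ^+ m, ..., r ^+ (m + size s)]. Keeping its exact value lets the induction telescope. *)
Lemma near_sum_head m a s : path near a s -> (m + size s <= a)%N ->
  (1 - r) * (\sum_(n <- a :: s) r ^+ n) <= r ^+ m - r ^+ (m + size s).+1.
Proof.
case/andP: (hr) => r0 r1.
elim: s a => [|b s IH] a /=.
  rewrite big_seq1 addn0 => _ /expr_anti ra.
  have : 0 <= (1 - r) * (r ^+ m - r ^+ a) by rewrite mulr_ge0 // subr_ge0 // ltW.
  rewrite exprS; lra.
move=> /andP[/andP[ab _] nbs] ma.
have {}IH : _ <= _ := IH b nbs ltac:(lia).
rewrite big_cons mulrDr.
have : 0 <= (1 - r) * (r ^+ (m + size s).+1 - r ^+ a).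
  by rewrite mulr_ge0 // subr_ge0 ?(ltW r1) // expr_anti //; lia.
rewrite addnS [r ^+ (_.+2)]exprS; lra.
Qed.

(** Counting back from the last entry, the [i]-th entry is at least [m + i]. *)
Lemma near_sum_last m a s : path near a s -> (m + size s <= last a s)%N ->
  (1 - r) * (\sum_(n <- a :: s) r ^+ n) <= r ^+ m.
Proof.
case/andP: (hr) => r0 r1.
elim: s a m => [|b s IH] a m nas ma.
  have := near_sum_head nas ma; have := exprn_ge0 (m + 0).+1 (ltW r0).
  rewrite /=; lra.
have [al _] := near_last nas.
move: nas => /= /andP[_ nbs].
have {}IH : _ <= _ := IH b m.+1 nbs ltac:(move: ma => /=; lia).
rewrite big_cons mulrDr.
have : 0 <= (1 - r) * (r ^+ m - r ^+ a).
  rewrite mulr_ge0 // subr_ge0 ?(ltW r1) // expr_anti //.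
  by move: ma al => /=; lia.
move: IH; rewrite exprS; lra.
Qed.

(** Cut the sequence after [a - m] steps, or at its end if it is shorter: the bound from the head
    serves before the cut, the bound from the last entry after it, and each costs [r ^+ m]. *)
Lemma near_sum m a s : path near a s -> (m.*2 + size s <= a + last a s)%N ->
  (1 - r) * (\sum_(n <- a :: s) r ^+ n) <= 2 * r ^+ m.
Proof.
case/andP: (hr) => r0 r1 nas ms.
have [l1 l2] := near_last nas.
rewrite -(cat_take_drop (a - m) s) in nas ms l1 l2 *.
have sz1 : (size (take (a - m) s) <= a - m)%N by rewrite size_take_min geq_minl.
have sz2 : size (take (a - m) s) = (a - m)%N \/ drop (a - m) s = [::].
  have [h|h] := leqP (a - m) (size s); first by left; rewrite size_takel.
  by right; rewrite drop_oversize // ltnW.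
move: (take _ _) (drop _ _) sz1 sz2 nas ms l1 l2 => s1 s2 sz1 sz2.
rewrite cat_path last_cat size_cat => /andP[n1 n2] ms l1 l2.
have h1 : _ <= _ := @near_sum_head m _ _ n1 ltac:(lia).
have ms2 : (m + size s2 <= last (last a s1) s2)%N.
  by case: sz2 => [|s20]; [lia | rewrite s20 /= in ms l1 l2 *; lia].
have := near_sum_last n2 ms2; rewrite big_cons mulrDr => h2.
rewrite -cat_cons big_cat /= mulrDr.
have := exprn_ge0 (m + size s1).+1 (ltW r0).
(* [h2] counts the entry at the cut a second time; this surplus is nonnegative. *)
have : 0 <= (1 - r) * r ^+ last a s1.
  by rewrite mulr_ge0 ?exprn_ge0 ?subr_ge0 ?ltW.
move: h1 h2; lra.
Qed.

Lemma small_expr c k : 0 < c -> 0 < k -> exists n, c * r ^+ n <= k.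
Proof.
case/andP: (hr) => r0 r1 c0 k0.
have : (fun n => r ^+ n) @ \oo --> (0 : R).
  by apply: cvg_expr; rewrite ger0_norm // ltW.
move=> /cvgrPdist_lt /(_ (k / c)); rewrite divr_gt0 // => /(_ isT)[n _ /(_ n)].
rewrite /= leqnn sub0r normrN ger0_norm ?exprn_ge0 ?ltW // => /(_ isT) h.
by exists n; rewrite mulrC -ler_pdivlMr // ltW.
Qed.

End SlowSequences.

(** * Walks in the augmented tree and the sets [Phi] along them *)

Section AugmentedTree.
Variables (R : realType) (d : nat) (X : choiceType) (Ev : rel X) (o : X).
Variable Phi : X -> set 'rV[R]_d.
Variables (delta0 r kappa : R).
Hypotheses (Evtree : is_tree Ev) (hA1 : condA1 Ev o Phi).

Local Notation lv := (level Ev o).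
Local Notation E := (augmented_edge Ev o Phi kappa r).
Implicit Types (x y z : X) (p : seq X) (a b c : 'rV[R]_d).

(** Climb from parent to parent, [Phi] growing by (A1). Both the upward and the downward walk are
    returned, so that walks can be concatenated without being reversed. *)
Lemma ancestor_ex x m : (m <= lv x)%N -> exists x' p q,
  [/\ lv x' = m, Phi x `<=` Phi x', walks E x x' p, walks E x' x q &
      size p = (lv x - m)%N /\ size q = (lv x - m)%N].
Proof.
move En : (lv x - m)%N => n.
elim: n x En => [|n IH] x En mx.
  exists x, [::], [::]; split=> //; lia.
have [u [lu ux xu]] := parent_ex Evtree (o := o) (n := (lv x).-1) (x := x) ltac:(lia).
have [x' [p [q [lx' sub [ep lp] wq [szp szq]]]]] := IH u ltac:(lia) ltac:(lia).
exists x', (u :: p), (rcons q x); split=> //.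
- exact: subset_trans (hA1 ux) sub.
- by split=> //=; rewrite ep andbT /augmented_edge xu.
- rewrite -cats1; apply: walks_cat wq _; split=> //=.
  by rewrite andbT /augmented_edge ux.2.
- by rewrite size_rcons /= szp szq.
Qed.

Lemma augmented_edge_near x y : E x y -> near (lv x) (lv y).
Proof.
rewrite /augmented_edge /near => /orP[/(level_edge Evtree o)|/and3P[/eqP]]; lia.
Qed.

Lemma augmented_path_near x p : path E x p -> path near (lv x) (map lv p).
Proof.
by elim: p x => //= y p IH x /andP[/augmented_edge_near -> /IH].
Qed.

Lemma augmented_walk_lipschitz x y p : walks E x y p ->
  (lv y <= lv x + size p)%N /\ (lv x <= lv y + size p)%N.
Proof.
move=> [ep <-]; have := near_last (augmented_path_near ep).
by rewrite last_map size_map.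
Qed.

Lemma walk_through_root x y :
  exists2 p, walks E x y p & size p = (lv x + lv y)%N.
Proof.
have [u [p [q [/(level0 Evtree) -> _ wp _ [szp _]]]]] :=
  ancestor_ex (leq0n (lv x)).
have [v [p' [q' [/(level0 Evtree) -> _ _ wq [_ szq]]]]] :=
  ancestor_ex (leq0n (lv y)).
exists (p ++ q'); first exact: walks_cat wp wq.
by rewrite size_cat szp szq !subn0.
Qed.

Lemma augmented_walks_neq0 x y : walks E x y !=set0.
Proof. by have [p wp _] := walk_through_root x y; exists p. Qed.

Lemma gdist_le_levels x y : (gdist E x y <= lv x + lv y)%N.
Proof.
have [p wp <-] := walk_through_root x y.
exact: (gdist_min (augmented_walks_neq0 x y)).2.
Qed.

(** The tree path gives the upper bound; the lower one holds because levels change by at most one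
    along an edge. *)
Lemma gdist_root x : gdist E o x = lv x.
Proof.
have [[p wp sz] gmin] := gdist_min (augmented_walks_neq0 o x).
have lo : lv o = 0%N by rewrite (@level_simple_path _ _ Evtree o o [::]).
have [h1 _] := augmented_walk_lipschitz wp; rewrite lo sz add0n in h1.
by apply/eqP; rewrite eqn_leq h1 (leq_trans (gdist_le_levels o x)) ?lo.
Qed.

(** The images of the ancestors at level [m] contain [a] and [b], so these ancestors are equal or
    horizontally adjacent: go up, across and down. At level 0 both are the root, hence the guard
    [0 < m]. *)
Lemma close_gdist x y a b m : (m <= lv x)%N -> (m <= lv y)%N ->
  Phi x a -> Phi y b -> (0 < m)%N ==> (enorm (a - b) <= kappa * r ^+ m) ->
  (gdist E x y + m.*2 <= lv x + lv y + 1)%N.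
Proof.
move=> mx my xa yb ab.
have [_ gmin] := gdist_min (augmented_walks_neq0 x y).
have [x' [p [_ [lx' subx wp _ [szp _]]]]] := ancestor_ex mx.
have [y' [_ [q [ly' suby _ wq [_ szq]]]]] := ancestor_ex my.
suff [s ws szs] : exists2 s, walks E x' y' s & (size s <= 1)%N.
  have := gmin _ (walks_cat wp (walks_cat ws wq)); rewrite !size_cat; lia.
have [-> | xy'] := eqVneq x' y'; first by exists [::].
exists [:: y'] => //; split=> //=.
rewrite andbT /augmented_edge /horizontal_edge lx' ly' eqxx xy' /=.
apply/orP; right.
have m0 : (0 < m)%N.
  case: m lx' ly' {mx my ab szp szq} => // /(level0 Evtree) xo /(level0 Evtree) yo.
  by rewrite xo yo eqxx in xy'.
rewrite m0 in ab.
by apply: le_trans ab; apply: set_dist_le; [exact: subx|exact: suby].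
Qed.

Hypothesis PhiK : forall x, nonempty_compact (Phi x).
Hypotheses (hdelta0 : 1 < delta0) (hr : 0 < r < 1) (hkappa : 0 < kappa).
Hypothesis hA2 : condA2 Ev o Phi delta0 r.

Let r_gt0 : 0 < r. Proof. by case/andP: hr. Qed.

Lemma enorm_le_level x a b : Phi x a -> Phi x b ->
  enorm (a - b) <= delta0 * r ^+ lv x.
Proof.
move=> xa xb; have /andP[lb ub] := hA2 (erefl (lv x)).
(* The lower bound in (A2) supplies the positive diameter that [enorm_le_diam] asks for. *)
apply: le_trans ub; apply: enorm_le_diam xa xb; apply: lt_le_trans lb.
by rewrite mulr_gt0 ?exprn_gt0 ?invr_gt0 // (lt_trans ltr01).
Qed.

(** Across a tree edge the sets are nested and share a point. Across a horizontal edge the factor 2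
    makes the inequality strict, so some pair of points realizes it. *)
Lemma augmented_edge_enorm x y : E x y -> exists a b,
  [/\ Phi x a, Phi y b & enorm (a - b) <= 2 * kappa * r ^+ lv x].
Proof.
have k0 : 0 < kappa * r ^+ lv x by rewrite mulr_gt0 ?exprn_gt0.
rewrite /augmented_edge => /orP[exy|/and3P[_ _ hxy]].
  suff [c [xc yc]] : exists c, Phi x c /\ Phi y c.
    exists c, c; split=> //; rewrite enorm_sub0; lra.
  have [lxy|lxy] := level_edge Evtree o exy.
    have [[c yc] _] := PhiK y; exists c; split=> //.
    exact: (hA1 (conj lxy exy)).
  have [[c xc] _] := PhiK x; exists c; split=> //.
  by apply: (hA1 (conj lxy _)) xc; case: Evtree => -[-> _].
have [|||a [b [xa yb ab]]] := @set_dist_lt _ _ (Phi x) (Phi y) (2 * kappa * r ^+ lv x).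
- by have [] := PhiK x.
- by have [] := PhiK y.
- by apply: le_lt_trans hxy _; lra.
by exists a, b; split=> //; exact: ltW.
Qed.

(** Each vertex costs a diameter, at most [delta0 * r ^+ n] at level [n], and each edge a gap, at
    most [2 * kappa * r ^+ n]. *)
Lemma augmented_walk_enorm x y p a b : walks E x y p -> Phi x a -> Phi y b ->
  enorm (a - b) <=
    (delta0 + 2 * kappa) * \sum_(n <- lv x :: map lv p) r ^+ n.
Proof.
have k0 w : 0 < kappa * r ^+ lv w by rewrite mulr_gt0 ?exprn_gt0.
elim: p x a => [|w p IH] x a [/= ep lp] xa yb.
  subst y; have := enorm_le_level xa yb; rewrite big_seq1.
  by have := k0 x; lra.
case/andP: ep => exw ep.
have [a' [w' [xa' ww' h]]] := augmented_edge_enorm exw.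
have h1 := IH w w' (conj ep lp) ww' yb.
have h2 := enorm_le_level xa xa'.
have h3 := enorm_triangle a a' b.
have h4 := enorm_triangle a' w' b.
rewrite big_cons mulrDr; move: h h1 h2 h3 h4; lra.
Qed.

(* The hypothesis on [m] says that [m] is at most the Gromov product. *)
Lemma gromov_enorm x y a b m : (m.*2 + gdist E x y <= lv x + lv y)%N ->
  Phi x a -> Phi y b ->
  enorm (a - b) <= 2 * (delta0 + 2 * kappa) / (1 - r) * r ^+ m.
Proof.
have [[p wp <-] _] := gdist_min (augmented_walks_neq0 x y).
move=> mxy xa yb; have := augmented_walk_enorm wp xa yb.
have : (m.*2 + size (map lv p) <= lv x + last (lv x) (map lv p))%N.
  by rewrite last_map size_map wp.2.
move/(near_sum hr (augmented_path_near wp.1)).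
move: (\sum_(_ <- _) _) => S hS hab.
have r1 : 0 < 1 - r by case/andP: hr; lra.
rewrite mulrAC ler_pdivlMr //.
have K0 : 0 < delta0 + 2 * kappa by move: hdelta0 hkappa; lra.
have := ler_wpM2l (ltW K0) hS; have := ler_wpM2r (ltW r1) hab; lra.
Qed.

End AugmentedTree.

Theorem theorem1p2 (R : realType) (d : nat) (X : choiceType) (Ev : rel X)
    (o : X) (Phi : X -> set 'rV[R]_d) (delta0 r kappa : R)
    (Xinf : infinite_set [set: X])
    (Evfin : locally_finite Ev)
    (Evtree : is_tree Ev)
    (PhiK : forall x, nonempty_compact (Phi x))
    (hdelta0 : 1 < delta0) (hr : 0 < r < 1)
    (hA1 : condA1 Ev o Phi)
    (hA2 : condA2 Ev o Phi delta0 r)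
    (hkappa : 0 < kappa) :
  hyperbolic R (augmented_edge Ev o Phi kappa r) o.
Proof.
set M := 2 * (delta0 + 2 * kappa) / (1 - r).
have M0 : 0 < M.
  by case/andP: hr => _ r1; rewrite divr_gt0 ?subr_gt0 // mulr_gt0 //; lra.
(* The detour through [Phi z] gives [2 * M * r ^+ m], which [k] levels higher is at most
   [kappa * r ^+ (m - k)]. *)
have [k hk] := small_expr hr (addr_gt0 M0 M0) hkappa.
(* Besides [k], one half is lost to the horizontal edge and at most one half to rounding in [m]. *)
exists (k%:R + 1) => [|x y z]; first by rewrite ltr_wpDl.
rewrite /gromov_product !(gdist_root r kappa Evtree hA1).
(* These two bounds make the natural subtractions in [m] exact; the Lipschitz bounds below put [m]
   under the levels of [x] and [y]. *)
have uxz := gdist_le_levels r kappa Evtree hA1 x z.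
have uzy := gdist_le_levels r kappa Evtree hA1 z y.
have [[p wp szp] _] := gdist_min (augmented_walks_neq0 r kappa Evtree hA1 x z).
have [[q wq szq] _] := gdist_min (augmented_walks_neq0 r kappa Evtree hA1 z y).
have := augmented_walk_lipschitz Evtree wp; rewrite szp => -[xz zx].
have := augmented_walk_lipschitz Evtree wq; rewrite szq => -[zy yz].
have gxz := @gromov_enorm _ _ _ _ _ _ _ _ _ Evtree hA1 PhiK hdelta0 hr hkappa hA2 x z.
have gzy := @gromov_enorm _ _ _ _ _ _ _ _ _ Evtree hA1 PhiK hdelta0 hr hkappa hA2 z y.
have cxy := @close_gdist _ _ _ _ _ _ r kappa Evtree hA1 x y.
move: (gdist _ x z) (gdist _ z y) (gdist _ x y) uxz uzy xz zx zy yz gxz gzy cxy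
  {p q wp wq szp szq} => dxz dzy dxy uxz uzy xz zx zy yz gxz gzy cxy.
have [[a xa] _] := PhiK x; have [[b yb] _] := PhiK y; have [[c zc] _] := PhiK z.
(* The integer part of the smaller of the two Gromov products. *)
pose m := (minn (level Ev o x + level Ev o z - dxz)
                (level Ev o z + level Ev o y - dzy))./2.
have ac := gxz a c m ltac:(lia) xa zc.
have cb := gzy c b m ltac:(lia) zc yb.
(* If [m <= k], the subtraction truncates to the root level and the guard is false. *)
have ab : (0 < m - k)%N ==> (enorm (a - b) <= kappa * r ^+ (m - k)).
  apply/implyP => mk; have := enorm_triangle a c b.
  have := ler_wpM2r (exprn_ge0 (m - k) (ltW (andP hr).1)) hk.
  rewrite -mulrA -exprD subnKC; last by lia.
  by move: ac cb; rewrite -/M; lra.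
have := cxy a b (m - k)%N ltac:(lia) ltac:(lia) xa yb ab.
rewrite -(ler_nat R) !natrD -muln2 natrM => hxy.
have hk' : (m%:R : R) <= k%:R + (m - k)%:R by rewrite -natrD ler_nat; lia.
(* The product attaining the minimum is at most [m + 1/2]. *)
have [h|h] : (level Ev o x + level Ev o z <= dxz + m.*2 + 1)%N \/
             (level Ev o z + level Ev o y <= dzy + m.*2 + 1)%N by lia.
- rewrite lerBlDr; rewrite ge_min; apply/orP; left.
  move: h; rewrite -(ler_nat R) !natrD -muln2 natrM; lra.
- rewrite lerBlDr; rewrite ge_min; apply/orP; right.
  move: h; rewrite -(ler_nat R) !natrD -muln2 natrM; lra.
Qed.
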